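(* Let $m$ and $d$ be fixed positive integers, let $H$ be any fixed, connected $d$-regular graph on $m$ vertices, and let $G\in\mathcal{G}_{n,d}$ be a random $d$-regular graph on $n$ vertices. Then there exists a constant $C$ (not depending on $n$) such that $$\mathbb{P}\left(\gamma(G,d_H)\le C\right)\to 1\quad\text{as } n\to\infty.$$
   Context: $\mathcal{G}_{n,d}$ denotes the uniform probability space of simple $d$-regular graphs on $n$ labelled vertices ($nd$ even). For a connected graph $H$, $d_H(x,y)$ is the usual graph distance on $V(H)$. For a $d$-regular graph $G$ on $n$ vertices and a metric space $(X,d_X)$, $\gamma(G,d_X)$ is the infimum over all constants $\gamma$ such that for all functions $f:V(G)\to X$, $$\frac{\gamma}{dn}\sum_{u\sim_G v} d_X^2(f(u),f(v))\ \ge\ \frac{1}{n^2}\sum_{u,v\in V(G)} d_X^2(f(u),f(v)),$$ with the usual convention that the infimum is $\infty$ if no such constant exists. The first sum is over adjacent pairs $u,v$ in $G$, the second over all pairs of vertices of $G$. Here $(X,d_X)=(V(H),d_H)$.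
   Formalization: The theorem assumes d ≥ 3 instead of d positive; for d = 1 and d = 2 the claim is false, because G is then disconnected with probability tending to 1, so γ(G,d_H) = ∞. *)

(* Defs.v *)
From HB Require Import structures.
From mathcomp Require Import all_boot all_order all_algebra.
From mathcomp Require Import all_classical all_reals all_analysis.

Set Implicit Arguments.
Unset Strict Implicit.
Unset Printing Implicit Defensive.

Import Order.TTheory GRing.Theory Num.Theory.
Import numFieldNormedType.Exports.

Local Open Scope classical_set_scope.
Local Open Scope ring_scope.

(* A simple graph on T, given by the set of its arcs: each edge {u, v} is
   recorded as both (u, v) and (v, u). *)
Definition simple_graph_axiom (T : finType) (A : {set T * T}) : bool :=
  [forall u, (u, u) \notin A] &&
  [forall u, forall v, ((u, v) \in A) == ((v, u) \in A)].

Record sgraph (T : finType) := SGraph {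
  arcs : {set T * T};
  _ : simple_graph_axiom arcs }.

HB.instance Definition _ (T : finType) := [isSub for @arcs T].
HB.instance Definition _ (T : finType) := [Countable of sgraph T by <:].
HB.instance Definition _ (T : finType) := [Finite of sgraph T by <:].

Definition adj (T : finType) (G : sgraph T) : rel T :=
  fun u v => (u, v) \in arcs G.

Definition regular (T : finType) (d : nat) (G : sgraph T) : bool :=
  [forall v, #|[pred u | adj G v u]| == d].

Definition connected_graph (T : finType) (G : sgraph T) : bool :=
  [forall u, forall v, connect (adj G) u v].

(* Least number of edges of a walk from x to y; only meaningful when y is
   reachable from x, since inf set0 = 0. *)
Definition graph_dist (R : realType) (T : finType) (G : sgraph T) (x y : T) : R :=
  inf [set (size p)%:R | p in [set p : seq T | path (adj G) x p /\ last x p = y]].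

(* The sum over adjacent pairs ranges over ordered pairs, i.e. over d * n terms
   when G is d-regular, to match the normalizing factor. *)
Definition poincare (R : realType) (n d : nat) (G : sgraph 'I_n)
    (X : Type) (dX : X -> X -> R) (c : R) : Prop :=
  forall f : 'I_n -> X,
    c / (d%:R * n%:R) *
      (\sum_(u : 'I_n) \sum_(v : 'I_n | adj G u v) dX (f u) (f v) ^+ 2) >=
    1 / n%:R ^+ 2 * (\sum_(u : 'I_n) \sum_(v : 'I_n) dX (f u) (f v) ^+ 2).

Definition gamma (R : realType) (n d : nat) (G : sgraph 'I_n)
    (X : Type) (dX : X -> X -> R) : \bar R :=
  ereal_inf [set c%:E | c in [set c : R | poincare d G dX c]].

(* Probability of E under the uniform distribution on d-regular simple graphs
   with vertex set 'I_n (0 when there are no such graphs). *)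
Definition prob_Gnd (R : realType) (n d : nat) (E : sgraph 'I_n -> Prop) : R :=
  #|[pred G : sgraph 'I_n | regular d G && `[< E G >]]|%:R /
  #|[pred G : sgraph 'I_n | regular d G]|%:R.
Arguments prob_Gnd R n d E : clear implicits.

(* Main.v *)
Require Import Defs.
From HB Require Import structures.
From mathcomp Require Import all_boot all_order all_algebra.
From mathcomp Require Import all_classical all_reals all_analysis.
From mathcomp Require Import fintype finset binomial.
From mathcomp Require Import zify ring lra.

Set Implicit Arguments.
Unset Strict Implicit.
Unset Printing Implicit Defensive.

Import Order.TTheory GRing.Theory Num.Theory.
Import numFieldNormedType.Exports.

(** Since H is fixed and finite, its metric is comparable to the discrete metric
    that gives distance 1 to all pairs of distinct points, and for the discrete
    metric the Poincare inequality is a sum of isoperimetric inequalities, one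
    for each level set of f ([expander_levels], [expander_poincare]). It is
    therefore enough that, with probability tending to 1, every set S of at most
    n/2 vertices of G has more than |S|/A edges to its complement, where the
    constant A depends on d only.

    This is a first moment argument over S, carried out directly on simple
    graphs. Write s = |S| and let g(k) be the number of d-regular graphs with
    exactly k edges between S and its complement. Replacing an edge xy inside S
    and an edge zw outside S by xz and yw turns k into k + 2; counting the ways
    to do and to undo this gives ([leq_switching])
      g(k) (ds - k) (d(n - s) - k - 2d^2) <= g(k + 2) (k + 2) (k + 1).
    Iterating i times, halving every factor, bounds g(k) C(p, i) C(q, i) by
    the number of all d-regular graphs times C(k + i, i)^2, where p and q are
    about ds/2 and d(n - s)/2 ([reg_cut_chain]). Summing over i, Vandermonde's
    identity replaces C(p, i) C(q, i) by C(p + q, p) ([leq_card_reg_cut]).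

    As d >= 3, p exceeds s by s/3 and q exceeds n - s by n/6, so C(p + q, p) is
    at least C(n, s) C(s/3 + n/6, s/3), and the second factor is at least
    (n/6 + 1) 2^(s/3 - 1): the gain beats the number C(n, s) of sets S and leaves
    a factor 1/n and an exponential in s. The loss C(k + ds, k)^2 is an
    exponential in s whose base tends to 1 as A grows, because k <= s/A
    ([bin_le_exp_small]). The sum over all S is thus at most a constant times
    1/n ([card_nonexpanders]).

    That the probability is not the degenerate quotient 0/0 is witnessed by the
    circulant graphs ([regs_neq0]). *)

(** * Arcs between two sets of vertices *)

Section Switching.
Variables (T : finType) (d : nat).
Implicit Types (G : sgraph T) (S : {set T}) (a b : T * T).

Lemma adj_irr G u : adj G u u = false.
Proof. by case: G => A /= /[dup] /andP[/forallP/(_ u) /negbTE]. Qed.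

Lemma adj_sym G u v : adj G u v = adj G v u.
Proof. by case: G => A /= /[dup] /andP[_ /forallP/(_ u)/forallP/(_ v)/eqP]. Qed.

Definition nbrs G v : {set T} := [set u | adj G v u].

Lemma regularP G : reflect (forall v, #|nbrs G v| = d) (regular d G).
Proof.
by apply: (iffP forallP) => h v; [rewrite cardsE; apply/eqP/h | rewrite -cardsE; apply/eqP/h].
Qed.

Definition arcs_between G S S' : {set T * T} :=
  [set a in arcs G | (a.1 \in S) && (a.2 \in S')].

Definition edge_cut G S : nat := #|arcs_between G S (~: S)|.

Lemma card_arcs_between G S S' :
  #|arcs_between G S S'| = \sum_(u in S) #|nbrs G u :&: S'|.
Proof.
rewrite -sum1_card (eq_bigl (fun a => (a.1 \in S) && (a.2 \in nbrs G a.1 :&: S'))).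
  rewrite -(pair_big_dep (fun u => u \in S) (fun u v => v \in nbrs G u :&: S')
     (fun _ _ => 1)) /=.
  by apply: eq_bigr => u _; rewrite sum1_card.
by case=> u v; rewrite !inE /= /adj andbCA.
Qed.

Lemma card_arcs_betweenC G S S' : #|arcs_between G S S'| = #|arcs_between G S' S|.
Proof.
have swap_inj : injective (fun a : T * T => (a.2, a.1)) by move=> [u v] [u' v'] [-> ->].
rewrite -(card_imset _ swap_inj); apply: eq_card => -[u v].
apply/imsetP/idP => [[[x y]]|].
  rewrite !inE /= => h [-> ->]; move: h.
  by rewrite -[(x, y) \in _]/(adj G x y) adj_sym (andbC (x \in S)).
rewrite !inE /= => h; exists (v, u) => //; rewrite !inE /=; move: h.
by rewrite -[(u, v) \in _]/(adj G u v) adj_sym (andbC (u \in S')).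
Qed.

Lemma edge_cutC G S : edge_cut G (~: S) = edge_cut G S.
Proof. by rewrite /edge_cut setCK card_arcs_betweenC. Qed.

Lemma card_arcs_inside G S : regular d G ->
  #|arcs_between G S S| = d * #|S| - edge_cut G S.
Proof.
move=> /regularP regG; rewrite /edge_cut !card_arcs_between.
suff <- : \sum_(u in S) #|nbrs G u :&: S| + \sum_(u in S) #|nbrs G u :&: ~: S| = d * #|S|.
  by rewrite addnK.
rewrite -big_split /= (eq_bigr (fun=> d)) => [|u _]; first by rewrite sum_nat_const mulnC.
by rewrite -setDE cardsID regG.
Qed.

(** * Switchings *)

(** The four edges exchanged by a switching at q = ((x, y), (z, w)), in both
    orientations. A switching is the symmetric difference with this set, so it is
    undone by the same symmetric difference; that makes it injective once q is
    known. *)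
Definition switch_arcs (q : (T * T) * (T * T)) : {set T * T} :=
  let: ((x, y), (z, w)) := q in
  [set (x, y); (y, x); (z, w); (w, z); (x, z); (z, x); (y, w); (w, y)].

(** Only meaningful when q is switchable: otherwise the symmetric difference
    need not be the arc set of a simple graph, and G itself is returned. *)
Definition switch (G : sgraph T) (q : (T * T) * (T * T)) : sgraph T :=
  insubd G [set a | (a \in arcs G) (+) (a \in switch_arcs q)].

Definition switchable (G : sgraph T) S (q : (T * T) * (T * T)) : bool :=
  let: ((x, y), (z, w)) := q in
  [&& (x, y) \in arcs_between G S S, (z, w) \in arcs_between G (~: S) (~: S),
      ~~ adj G x z & ~~ adj G y w].
Arguments switchable : simpl never.

Lemma switchable_facts G S x y z w : switchable G S ((x, y), (z, w)) ->
  [/\ [/\ x \in S, y \in S, z \notin S & w \notin S],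
      [/\ adj G x y, adj G z w, ~~ adj G x z & ~~ adj G y w],
      [/\ x != y, z != w & x != z] & [/\ x != w, y != z & y != w]].
Proof.
case/and4P; rewrite !inE /= => /and3P[xy xS yS] /and3P[zw zS wS] xz yw.
have neqS u v : u \in S -> v \notin S -> u != v.
  by move=> uS; apply: contraNneq => <-.
have neq_adj u v : (u, v) \in arcs G -> u != v.
  by move=> uv; apply/eqP => euv; move: (adj_irr G u); rewrite /adj {2}euv uv.
by split; split=> //; first [exact: neqS | exact: neq_adj].
Qed.

Lemma adj_switch G S q u v : switchable G S q ->
  adj (switch G q) u v = adj G u v (+) ((u, v) \in switch_arcs q).
Proof.
move=> sw; rewrite /adj /switch.
suff ax : simple_graph_axiom [set a | (a \in arcs G) (+) (a \in switch_arcs q)].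
  by rewrite -[arcs _]/(val _) insubdK // inE.
case: q sw => -[x y] [z w] /switchable_facts [_ _ [xy zw xz] [xw yz yw]].
have neq_eq2 (a b c : T) : a != b ->
    ((c == a) && (c == b) = false) * ((c == b) && (c == a) = false).
  by move=> ab; case: (eqVneq c a) => [->|_]; rewrite ?(negbTE ab) ?andbF.
apply/andP; split; apply/forallP => {}u.
  rewrite inE -[_ \in arcs G]/(adj G u u) adj_irr !inE !xpair_eqE /=.
  by rewrite !(neq_eq2 _ _ _ xy, neq_eq2 _ _ _ zw, neq_eq2 _ _ _ xz, neq_eq2 _ _ _ yw).
apply/forallP => {}v; apply/eqP; rewrite [LHS]in_set [RHS]in_set; congr (_ (+) _).
  exact: adj_sym.
suff P_sym u' v' : (u', v') \in switch_arcs ((x, y), (z, w)) ->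
    (v', u') \in switch_arcs ((x, y), (z, w)).
  by apply/idP/idP => /P_sym.
rewrite !inE => uv; repeat case/orP: uv => uv; move/eqP: uv => [-> ->];
  by rewrite !eqxx ?orbT.
Qed.

(** A switching only affects the neighbours of x, y, z and w, and there it
    replaces one neighbour by another one. *)
Lemma card_toggle (A B : {set T}) (a b : T) :
  a \in A -> b \notin A -> (forall u, (u \in B) = (u \in A) (+) ((u == a) || (u == b))) ->
  #|B| = #|A|.
Proof.
move=> aA bA Bdef; rewrite (cardsD1 a A) aA.
have -> : B = b |: (A :\ a).
  apply/setP => u; rewrite Bdef !inE.
  case: (eqVneq u b) => [->|_]; first by rewrite (negbTE bA) orbT.
  by case: (eqVneq u a) => [->|_]; rewrite ?aA //= addbF.
by rewrite cardsU1 !inE (negbTE bA) andbF.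
Qed.

Lemma regular_switch G S q : switchable G S q -> regular d G -> regular d (switch G q).
Proof.
move=> sw /regularP regG; apply/regularP => v; rewrite -(regG v).
have memG' u : (u \in nbrs (switch G q) v) = (u \in nbrs G v) (+) ((v, u) \in switch_arcs q).
  by rewrite !inE (adj_switch _ _ sw).
case: q sw memG' => -[x y] [z w] /switchable_facts.
move=> [_ [Gxy Gzw Gxz Gyw] [xy zw xz] [xw yz yw]] memG'.
have key (a b : T) : adj G v a -> ~~ adj G v b ->
    (forall u, ((v, u) \in switch_arcs ((x, y), (z, w))) = (u == a) || (u == b)) ->
    #|nbrs (switch G ((x, y), (z, w))) v| = #|nbrs G v|.
  move=> va vb row; apply: (@card_toggle _ _ a b); rewrite ?inE // => u.
  by rewrite memG' row.
have E := (negbTE xy, negbTE zw, negbTE xz, negbTE xw, negbTE yz, negbTE yw).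
have E' := (eq_sym y x, eq_sym w z, eq_sym z x, eq_sym w x, eq_sym z y, eq_sym w y).
case: (eqVneq v x) => [vx|vx].
  apply: (key y z); rewrite ?vx // => u.
  by rewrite !inE !xpair_eqE ?vx !eqxx !E /= !orbF.
case: (eqVneq v y) => [vy|vy].
  apply: (key x w); rewrite ?vy 1?(adj_sym G y x) // => u.
  by rewrite !inE !xpair_eqE ?vy !eqxx !E' !E /= !orbF.
case: (eqVneq v z) => [vz|vz].
  apply: (key w x); rewrite ?vz 1?(adj_sym G z x) // => u.
  by rewrite !inE !xpair_eqE ?vz !eqxx !E' !E /= !orbF.
case: (eqVneq v w) => [vw|vw].
  apply: (key z y); rewrite ?vw 1?(adj_sym G w) // => u.
  by rewrite !inE !xpair_eqE ?vw !eqxx !E' !E /= !orbF.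
apply: eq_card => u; rewrite memG' !inE !xpair_eqE.
by rewrite (negbTE vx) (negbTE vy) (negbTE vz) (negbTE vw) /= addbF.
Qed.

Lemma edge_cut_switch G S x y z w : switchable G S ((x, y), (z, w)) ->
  let C' := arcs_between (switch G ((x, y), (z, w))) S (~: S) in
  [/\ (x, z) \in C', (y, w) \in C', (x, z) != (y, w) & #|C'| = (edge_cut G S).+2].
Proof.
move=> sw /=; set C' := arcs_between _ _ _.
have [[xS yS zS wS] [Gxy Gzw Gxz Gyw] [xy zw xz] [xw yz yw]] := switchable_facts sw.
have C'E : C' = (x, z) |: ((y, w) |: arcs_between G S (~: S)).
  apply/setP => -[u v]; rewrite !in_setU1 ![_ \in arcs_between _ _ _]inE /= !in_setC.
  rewrite -[(u, v) \in arcs (switch _ _)]/(adj _ u v) (adj_switch _ _ sw).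
  rewrite -[(u, v) \in arcs G]/(adj G u v) !inE !xpair_eqE.
  have E := (negbTE xy, negbTE zw, negbTE xz, negbTE xw, negbTE yz, negbTE yw).
  have neqS (a b : T) : a \in S -> b \notin S -> (a == b = false) * (b == a = false).
    by move=> aS bS; rewrite (eq_sym b); split; apply: contraNF bS => /eqP <-.
  case: (eqVneq u x) => [->|_].
    rewrite xS ?eqxx !E /= !orbF.
    case: (eqVneq v z) => [->|_]; first by rewrite zS (negbTE Gxz) orbT.
    by case: (boolP (v \in S)) => [vS|vS]; rewrite ?andbF // !(neqS _ v) ?addbF ?orbF.
  case: (eqVneq u y) => [->|_].
    rewrite yS ?eqxx !E /= !orbF.
    case: (eqVneq v w) => [->|_]; first by rewrite wS (negbTE Gyw) orbT.
    by case: (boolP (v \in S)) => [vS|vS]; rewrite ?andbF // !(neqS _ v) ?addbF ?orbF.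
  case: (boolP (u \in S)) => [uS|uS]; rewrite ?andbF //= !(neqS u) //=.
  by rewrite ?orbF addbF.
have neq : (x, z) != (y, w) by rewrite xpair_eqE (negbTE xy).
have xzC : (x, z) \notin arcs_between G S (~: S) by rewrite inE negb_and Gxz.
have ywC : (y, w) \notin arcs_between G S (~: S) by rewrite inE negb_and Gyw.
split=> //; rewrite C'E ?inE ?eqxx ?orbT // !cardsU1 in_setU1 negb_or neq xzC ywC.
by rewrite !add1n.
Qed.

(** An arc inside S and an arc outside S form a switchable pair unless they are
    joined by one of two forbidden edges; as the graph is d-regular, an arc (x, y)
    excludes at most d^2 arcs starting at a neighbour of x and at most d^2 arcs
    ending at a neighbour of y. *)
Lemma card_switchable G S : regular d G ->
  (d * #|S| - edge_cut G S) * (d * #|~: S| - edge_cut G S - 2 * d ^ 2)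
    <= #|[set q | switchable G S q]|.
Proof.
move=> regG; have := card_arcs_inside S regG; have := card_arcs_inside (~: S) regG.
rewrite edge_cutC => <- <-; set I := arcs_between G S S; set J := arcs_between _ _ _.
pose ok (a b : T * T) := ~~ adj G a.1 b.1 && ~~ adj G a.2 b.2.
have -> : #|[set q | switchable G S q]| = \sum_(a in I) #|[set b in J | ok a b]|.
  rewrite -sum1_card (eq_bigl (fun q => (q.1 \in I) && (q.2 \in [set b in J | ok q.1 b]))).
    rewrite -(pair_big_dep (fun a => a \in I) (fun a b => b \in [set b in J | ok a b])
      (fun _ _ => 1)) /=.
    by apply: eq_bigr => a _; rewrite sum1_card.
  by case=> -[x y] [z w]; rewrite in_set [in RHS]in_set.
rewrite -sum_nat_const; apply: leq_sum => a _.
have card_nbrs v : #|nbrs G v| = d by move/regularP: regG; apply.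
have card2 v : #|arcs_between G (nbrs G v) [set: T]| = d ^ 2.
  rewrite card_arcs_between (eq_bigr (fun=> d)) => [|u _]; last by rewrite setIT.
  by rewrite sum_nat_const card_nbrs.
have sub : J \subset [set b in J | ok a b] :|:
    (arcs_between G (nbrs G a.1) [set: T] :|: arcs_between G [set: T] (nbrs G a.2)).
  apply/subsetP => b bJ; have bG : b \in arcs G by move: bJ; rewrite inE => /andP[].
  rewrite !in_setU ![_ \in arcs_between _ _ _]inE /= in_set bJ bG !inE /ok.
  by case: (adj G a.1 b.1); case: (adj G a.2 b.2).
have := subset_leq_card sub.
move=> /leq_trans /(_ (leq_card_setU _ _)) => leJ.
rewrite leq_subLR (leq_trans leJ) // addnC leq_add2r.
rewrite (leq_trans (leq_card_setU _ _)) //.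
by rewrite (card_arcs_betweenC _ [set: T]) !card2 mul2n addnn.
Qed.

Definition reg_cut S k : {set sgraph T} := [set G | regular d G && (edge_cut G S == k)].

(** The graph obtained by a switching, together with its two new arcs from S to
    the complement of S, determines the original graph and the pair of arcs. The
    left side bounds from below the number of ways to switch, the right side is
    the number of graphs with two marked crossing arcs. *)
Lemma leq_switching S k :
  #|reg_cut S k| * ((d * #|S| - k) * (d * #|~: S| - k - 2 * d ^ 2))
    <= #|reg_cut S k.+2| * (k.+2 * k.+1).
Proof.
pose A := [set Gq : sgraph T * ((T * T) * (T * T)) |
  (Gq.1 \in reg_cut S k) && switchable Gq.1 S Gq.2].
pose crossing G := arcs_between G S (~: S).
pose B := [set Gq : sgraph T * ((T * T) * (T * T)) | (Gq.1 \in reg_cut S k.+2) &&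
  [&& Gq.2.1 \in crossing Gq.1, Gq.2.2 \in crossing Gq.1 & Gq.2.1 != Gq.2.2]].
pose phi (Gq : sgraph T * ((T * T) * (T * T))) :=
  (switch Gq.1 Gq.2, ((Gq.2.1.1, Gq.2.2.1), (Gq.2.1.2, Gq.2.2.2))).
have cardA : #|reg_cut S k| * ((d * #|S| - k) * (d * #|~: S| - k - 2 * d ^ 2)) <= #|A|.
  rewrite -[#|A|]sum1_card (eq_bigl (fun Gq : sgraph T * ((T * T) * (T * T)) =>
    (Gq.1 \in reg_cut S k) && (Gq.2 \in [set q | switchable Gq.1 S q]))); last first.
    by move=> Gq; rewrite !inE.
  rewrite -(pair_big_dep (fun G => G \in reg_cut S k)
     (fun G q => q \in [set q | switchable G S q]) (fun _ _ => 1)) /=.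
  rewrite -sum_nat_const leq_sum // => G; rewrite inE => /andP[regG /eqP cutG].
  by rewrite sum1_card -cutG card_switchable.
have cardB : #|B| = #|reg_cut S k.+2| * (k.+2 * k.+1).
  rewrite -[#|B|]sum1_card (eq_bigl (fun Gq : sgraph T * ((T * T) * (T * T)) =>
    (Gq.1 \in reg_cut S k.+2) && (Gq.2 \in [set q | [&& q.1 \in crossing Gq.1,
       q.2 \in crossing Gq.1 & q.1 != q.2]]))); last first.
    by move=> Gq; rewrite [Gq \in B]in_set [Gq.2 \in _]in_set.
  rewrite -(pair_big_dep (fun G => G \in reg_cut S k.+2)
     (fun G q => q \in [set q | [&& q.1 \in crossing G,
       q.2 \in crossing G & q.1 != q.2]]) (fun _ _ => 1)) /=.
  rewrite -sum_nat_const; apply: eq_bigr => G; rewrite inE => /andP[regG /eqP cutG].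
  rewrite (eq_bigl (fun q => (q.1 \in crossing G) && (q.2 \in crossing G :\ q.1))).
    rewrite -(pair_big_dep (fun a => a \in crossing G)
      (fun a b => b \in crossing G :\ a) (fun _ _ => 1)) /=.
    rewrite (eq_bigr (fun=> k.+1)) => [|a aC].
      by rewrite sum_nat_const -[#|_|]/(edge_cut G S) cutG.
    have := cardsD1 a (crossing G).
    by rewrite aC sum1_card -[#|crossing G|]/(edge_cut G S) cutG add1n => -[].
  by case=> a b; rewrite in_set in_setD1 /= (eq_sym b) (andbC (a != b)).
apply: leq_trans cardA _; rewrite -cardB.
have inj_phi : {in A &, injective phi}.
  move=> [G [[x y] [z w]]] [G' [[x' y'] [z' w']]]; rewrite !in_set /=.
  move=> /andP[_ sw] /andP[_ sw'] [eG ex ez ey ew]; subst x' y' z' w'; congr (_, _).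
  apply/val_inj/setP => -[u v].
  have := adj_switch u v sw; rewrite eG (adj_switch u v sw') /adj.
  by move/addIb.
rewrite -(card_in_imset inj_phi); apply/subset_leq_card/subsetP => _ /imsetP[Gq AGq ->].
case: Gq AGq => [G [[x y] [z w]]]; rewrite [_ \in A]in_set [_ \in reg_cut _ _]in_set.
rewrite [_ \in B]in_set [_ \in reg_cut _ _]in_set /= => /andP[/andP[regG /eqP cutG] sw].
have [xz yw neq cC] := edge_cut_switch sw.
by rewrite (regular_switch sw) //= /edge_cut cC cutG eqxx xz yw neq.
Qed.

End Switching.

(** * Iterating the switching *)

Lemma sum_bin2 p q : \sum_(i < p.+1) 'C(p, i) * 'C(q, i) = 'C(p + q, p).
Proof.
rewrite addnC -binomial.Vandermonde; apply: eq_bigr => i _.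
by rewrite mulnC bin_sub // -ltnS.
Qed.

(** One term of Vandermonde's identity. *)
Lemma leq_bin_mul n m k l : 'C(n, k) * 'C(m, l) <= 'C(n + m, k + l).
Proof.
rewrite -binomial.Vandermonde (bigD1 (Ordinal (leq_addr l k : k < (k + l).+1))) //=.
by rewrite addKn leq_addr.
Qed.

Lemma leq_bin_add r c r' c' : r <= r' -> c <= c' -> 'C(r + c, r) <= 'C(r' + c', r').
Proof.
move=> ler lec; apply: (@leq_trans 'C(r + c', r)).
  by rewrite leq_bin2l ?leq_add2l.
rewrite -(bin_sub (leq_addr c' r)) -(bin_sub (leq_addr c' r')) !addKn.
by rewrite leq_bin2l ?leq_add2r.
Qed.

(** In C(r + 1 + c, r + 1), the product of the (c + j)/j for 1 <= j <= r + 1, the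
    first factor is c + 1 and the others are at least 2. *)
Lemma bin_pow2 r c : r < c -> c.+1 * 2 ^ r <= 'C(r.+1 + c, r.+1).
Proof.
elim: r => [|r IH] rc; first by rewrite bin1 muln1 add1n.
have := IH (ltnW rc) => {}IH.
have := mul_bin_diag (r.+2 + c) r.+1; rewrite [r.+2 + c]addSn /=.
by rewrite expnS; nia.
Qed.

(** After i switchings. Both (k + 2i + 2) and (k + 2i + 1) are at most twice
    k + i + 1, so each step of [leq_switching] costs the square of
    (k + i + 1) against (p - i) (q - i), which are the factors by which the
    binomial coefficients change when i grows by 1. *)
Lemma reg_cut_chain (T : finType) d (S : {set T}) k p q i :
  p.*2 <= d * #|S| - k -> q.*2 <= d * #|~: S| - k - 2 * d ^ 2 ->
  #|reg_cut d S k| * ('C(p, i) * 'C(q, i)) <= #|reg_cut d S (k + i.*2)| * 'C(k + i, i) ^ 2.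
Proof.
move=> lep leq'; elim: i => [|i IH]; first by rewrite !bin0 addn0 !muln1.
have := leq_switching d S (k + i.*2).
have := mul_bin_left p i; have := mul_bin_left q i.
have /= := mul_bin_diag (k + i).+1 i.
rewrite doubleS !addnS.
set P := 'C(p, i.+1); set Q := 'C(q, i.+1); set K := 'C((k + i).+1, i.+1).
move=> EK EQ EP; set g0 := #|reg_cut d S k| in IH *.
set g1 := #|reg_cut d S (k + i.*2)| in IH *; set g2 := #|reg_cut d S (k + i.*2).+2| => sw.
have {}lep : 2 * (p - i) <= d * #|S| - (k + i.*2) by lia.
have {}leq' : 2 * (q - i) <= d * #|~: S| - (k + i.*2) - 2 * d ^ 2 by lia.
have step : g1 * ((p - i) * (q - i)) <= g2 * (k + i).+1 ^ 2.
  have le4 : (k + i.*2).+2 * (k + i.*2).+1 <= (2 * (k + i).+1) * (2 * (k + i).+1).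
    by apply: leq_mul; lia.
  have := leq_trans (leq_mul (leqnn g1) (leq_mul lep leq'))
    (leq_trans sw (leq_mul (leqnn g2) le4)).
  have -> : g1 * (2 * (p - i) * (2 * (q - i))) = 4 * (g1 * ((p - i) * (q - i))).
    by clear; ring.
  have -> : g2 * (2 * (k + i).+1 * (2 * (k + i).+1)) = 4 * (g2 * (k + i).+1 ^ 2).
    by clear; ring.
  by rewrite leq_pmul2l.
rewrite -(@leq_pmul2l (i.+1 ^ 2)) ?expn_gt0 //.
have -> : i.+1 ^ 2 * (g0 * (P * Q)) = g0 * ((i.+1 * P) * (i.+1 * Q)) by clear; ring.
have -> : i.+1 ^ 2 * (g2 * K ^ 2) = g2 * (i.+1 * K) ^ 2 by clear; ring.
rewrite EP EQ -EK; set X := 'C(p, i) in IH *; set Y := 'C(q, i) in IH *.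
set Z := 'C(k + i, i) in IH *.
have -> : g0 * ((p - i) * X * ((q - i) * Y)) = g0 * (X * Y) * ((p - i) * (q - i)).
  by clear; ring.
apply: leq_trans (leq_mul IH (leqnn _)) _.
have -> : g2 * ((k + i).+1 * Z) ^ 2 = g2 * (k + i).+1 ^ 2 * Z ^ 2 by clear; ring.
by rewrite mulnAC leq_mul.
Qed.

Definition regs (T : finType) d : {set sgraph T} := [set G | regular d G].

(** Summing the previous bound over i <= p, where Vandermonde's identity collects
    the left sides. *)
Lemma leq_card_reg_cut (T : finType) d (S : {set T}) k p q :
  p.*2 <= d * #|S| - k -> q.*2 <= d * #|~: S| - k - 2 * d ^ 2 ->
  #|reg_cut d S k| * 'C(p + q, p) <= #|regs T d| * (p.+1 * 'C(k + p, k) ^ 2).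
Proof.
move=> lep leq'; rewrite -sum_bin2 big_distrr /= mulnCA.
rewrite -[p.+1 in leqRHS]card_ord -sum_nat_const leq_sum // => i _.
apply: leq_trans (reg_cut_chain i lep leq') _; rewrite leq_mul //.
  by apply/subset_leq_card/subsetP => G; rewrite !inE => /andP[].
rewrite leq_exp2r // -(bin_sub (leq_addl k i)) addnK leq_bin2l // leq_add2l.
by rewrite -ltnS.
Qed.

(** * Graphs with few edges leaving a given set *)

Definition few_crossings (T : finType) d A (S : {set T}) : {set sgraph T} :=
  [set G | regular d G && (A * edge_cut G S <= #|S|)].

(** A vertex of a set without outgoing edges has all its d neighbours in it. *)
Lemma isolated_card (T : finType) d (G : sgraph T) (S : {set T}) :
  regular d G -> 0 < #|S| -> edge_cut G S = 0 -> d < #|S|.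
Proof.
move=> /regularP regG /card_gt0P[u uS]; rewrite /edge_cut card_arcs_between => cut0.
have sub : u |: nbrs G u \subset S.
  apply/subsetP => v; rewrite in_setU1 => /predU1P[->//|uv].
  apply: contraT => vS; move: cut0; rewrite (bigD1 u) //= (cardD1 v) !inE.
  by move: uv; rewrite inE => ->; rewrite vS.
by apply: leq_trans (subset_leq_card sub); rewrite cardsU1 regG inE adj_irr.
Qed.

(** The gain over the union bound: since d >= 3, half the degree sums of S and
    of its complement exceed s and n - s by at least s/3 and n/6, even after k and
    2d^2 have been taken off; for this k must be a small fraction of s, and d^2 a
    small fraction of n. *)
Lemma leq_card_reg_cut_expand (T : finType) d A (S : {set T}) k :
  2 < d -> 200 <= A -> 24 * d ^ 2 <= #|T| -> #|S|.*2 <= #|T| -> 2 < #|S| -> A * k <= #|S| ->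
  #|reg_cut d S k| * ('C(#|T|, #|S|) * ((#|T| %/ 6).+1 * 2 ^ (#|S| %/ 3))) <=
    2 * (#|regs T d| * (d * #|S|.+1 * 'C(k + d * #|S|, k) ^ 2)).
Proof.
move=> d3 A200 n24 S2 S3 Ak; have := cardsC S.
set s := #|S| in S2 S3 Ak *; set n := #|T| in n24 S2 *; set s' := #|~: S| => nE.
have k200 : 200 * k <= s by apply: leq_trans Ak; rewrite leq_mul2r A200 orbT.
have ds : 3 * s <= d * s by rewrite leq_mul2r d3 orbT.
have ds' : 3 * s' <= d * s' by rewrite leq_mul2r d3 orbT.
pose p := (d * s - k)./2; pose q := (d * s' - k - 2 * d ^ 2)./2.
have lep : p.*2 <= d * s - k by rewrite /p; lia.
have leq' : q.*2 <= d * s' - k - 2 * d ^ 2 by rewrite /q; lia.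
have := leq_card_reg_cut lep leq'; set g := #|_| => main.
have p_ge : s + s %/ 3 <= p by rewrite /p; clear -ds k200; lia.
have q_ge : s' + n %/ 6 <= q.
  by rewrite /q; move: (d ^ 2) n24 => d2 n24; clear -ds' k200 n24 S2 nE; lia.
(* p + q splits as n + (s/3 + n/6 + rest), and p as s + (s/3 + rest). *)
have binpq : 'C(n, s) * ((n %/ 6).+1 * 2 ^ (s %/ 3)) <= 2 * 'C(p + q, p).
  apply: leq_trans (_ : 2 * ('C(n, s) * 'C(s %/ 3 + n %/ 6, s %/ 3)) <= _); last first.
    rewrite leq_mul2l /=; apply: leq_trans (leq_bin_mul _ _ _ _) _.
    by rewrite -{1}nE addnACA leq_bin_add.
  rewrite [leqRHS]mulnCA leq_mul2l; apply/orP; right.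
  have [r rE] : exists r, s %/ 3 = r.+1 by exists (s %/ 3).-1; lia.
  by rewrite rE expnS mulnCA leq_mul2l /= bin_pow2 // -rE; lia.
apply: leq_trans (leq_mul (leqnn g) binpq) _.
rewrite mulnCA leq_mul2l /=; apply: leq_trans main _.
rewrite leq_mul2l leq_mul ?orbT //.
  rewrite mulnS; apply: leq_trans (_ : (d * s).+1 <= _); last by clear -d3; lia.
  by rewrite /p; lia.
rewrite leq_exp2r // leq_bin2l // leq_add2l /p; lia.
Qed.

Local Open Scope ring_scope.

Section Estimates.
Variable R : realFieldType.

Lemma Bernoulli_ineq (x : R) n : 0 <= x -> 1 + x *+ n <= (1 + x) ^+ n.
Proof.
move=> x0; elim: n => [|n IH]; first by rewrite mulr0n addr0 expr0.
rewrite exprS; apply: le_trans (ler_wpM2l _ IH); last by rewrite addr_ge0.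
rewrite mulrDl mul1r mulrDr mulr1 mulrS mulrnAr; have : 0 <= x * x *+ n.
  by rewrite mulrn_wge0 // mulr_ge0.
by move=> h; lra.
Qed.

(** The coefficient 2^n - 1, unlike 2^n, is stable under the induction. *)
Lemma expr1D_le (x : R) n : 0 <= x <= 1 -> (1 + x) ^+ n <= 1 + 2 ^+ n * x.
Proof.
move=> /andP[x0 x1]; apply: (@le_trans _ _ (1 + (2 ^+ n - 1) * x)); last by lra.
elim: n => [|n IH]; first by rewrite !expr0 subrr mul0r addr0.
rewrite exprS; apply: le_trans (ler_wpM2l _ IH) _; first by rewrite addr_ge0.
have : 1 <= 2 ^+ n :> R by rewrite exprn_ege1 // ler1n.
rewrite exprS; set y := 2 ^+ n => y1.
have : (y - 1) * x * x <= (y - 1) * x by rewrite ler_piMr // mulr_ge0 // subr_ge0.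
by move=> h; lra.
Qed.

(** One term of the binomial expansion of (1 + 1/T)^N. *)
Lemma bin_le_expr (N k T : nat) : (0 < T)%N ->
  'C(N, k)%:R <= T%:R ^+ k * (1 + T%:R^-1) ^+ N :> R.
Proof.
move=> T0; have T0R : 0 < T%:R :> R by rewrite ltr0n.
have [kN|kN] := leqP k N; last first.
  by rewrite bin_small // mulr_ge0 ?exprn_ge0 ?addr_ge0 ?invr_ge0 ?ler0n.
rewrite (addrC 1) exprD1n (bigD1 (Ordinal (kN : (k < N.+1)%N))) //= mulrDr.
rewrite mulrnAr exprVn mulfV ?expf_neq0 ?gt_eqF // lerDl mulr_ge0 ?exprn_ge0 ?ler0n //.
by apply: sumr_ge0 => i _; rewrite mulrn_wge0 // exprn_ge0 // invr_ge0 ler0n.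
Qed.

(** As a value of T in [bin_le_expr], large enough for
    (1 + 1/T)^(d + 1) <= 101/100. *)
Definition expansion_scale (d : nat) : nat := (100 * 2 ^ d.+1)%N.

(** The inverse A of the edge expansion that is proved for most graphs; large
    enough for T <= (101/100)^A by Bernoulli's inequality. *)
Definition expansion_inv (d : nat) : nat := (100 * expansion_scale d)%N.

(** With N = k + ds the bound T^k (1 + 1/T)^N of [bin_le_expr] splits into two
    factors, each at most (101/100)^s. *)
Lemma bin_le_exp_small (d s k : nat) : (expansion_inv d * k <= s)%N ->
  'C(k + d * s, k)%:R <= (101%:R / 100%:R) ^+ (2 * s) :> R.
Proof.
set A := expansion_inv d; set T := expansion_scale d => Ak.
have T0 : (0 < T)%N by rewrite muln_gt0 expn_gt0.
have T0R : 0 < T%:R :> R by rewrite ltr0n.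
pose rho : R := 101%:R / 100%:R; have rho1 : 1 <= rho by rewrite /rho; lra.
have x1 : 1 <= 1 + T%:R^-1 :> R by rewrite lerDl invr_ge0 ler0n.
have x0 : 0 <= 1 + T%:R^-1 :> R by apply: le_trans x1.
have rho0 : 0 <= rho by apply: le_trans rho1.
apply: le_trans (bin_le_expr _ _ T0) _.
rewrite mul2n -addnn [leRHS]exprD ler_pM ?exprn_ge0 ?ler0n //.
  apply: le_trans (_ : (rho ^+ A) ^+ k <= _); last by rewrite -exprM ler_weXn2l.
  rewrite lerXn2r ?nnegrE ?exprn_ge0 ?ler0n //.
  have -> : rho = 1 + 100%:R^-1 by rewrite /rho; field.
  apply: le_trans (Bernoulli_ineq _ _); last by rewrite invr_ge0 ler0n.
  have -> : 100%:R^-1 *+ A = T%:R :> R.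
    by rewrite -(mulr_natr _ A) /A /expansion_inv natrM mulKf ?pnatr_eq0.
  by rewrite lerDr.
apply: le_trans (_ : (1 + T%:R^-1) ^+ (d.+1 * s) <= _).
  rewrite ler_weXn2l //; have : (0 < A)%N by rewrite muln_gt0 T0.
  by nia.
rewrite exprM lerXn2r ?nnegrE ?exprn_ge0 //.
apply: le_trans (expr1D_le _ _) _.
  by rewrite invr_ge0 ler0n /= invf_le1 // ler1n.
rewrite /T /expansion_scale natrM invfM mulrCA natrX mulfV ?expf_neq0 ?pnatr_eq0 //.
by rewrite /rho; lra.
Qed.

Definition union_const (d : nat) : R := 31250%:R * d%:R.

(** The decay rate 9/10 comes from 2^(-1/3) < 4/5 and (101/100)^6 < 9/8: the sixth
    power of 101/100 collects four from the squared binomial coefficient and two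
    from the factor (s + 1)^2, each s + 1 being at most 100 (101/100)^s. The
    constant is 2 * 100^2 * 25/16, where 25/16 bounds the rounding in s/3. *)
Lemma card_reg_cut_le (T : finType) d (S : {set T}) k :
  (2 < d)%N -> (24 * d ^ 2 <= #|T|)%N -> (#|S|.*2 <= #|T|)%N -> (2 < #|S|)%N ->
  (expansion_inv d * k <= #|S|)%N ->
  #|reg_cut d S k|%:R * (#|S|.+1%:R * ('C(#|T|, #|S|)%:R * (#|T| %/ 6).+1%:R)) <=
    #|regs T d|%:R * union_const d * (9%:R / 10%:R) ^+ #|S| :> R.
Proof.
move=> d3 n24 S2 S3 Ak.
have A200 : (200 <= expansion_inv d)%N.
  by rewrite /expansion_inv /expansion_scale expnS; have := expn_gt0 2 d; lia.
have := leq_card_reg_cut_expand d3 A200 n24 S2 S3 Ak.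
rewrite -(ler_nat R) !natrM natrX.
have := bin_le_exp_small Ak; set c := 'C(k + _, _)%:R => c_le.
set s := #|S| in S2 S3 Ak c_le *; set g := #|reg_cut _ _ _|%:R.
set b := 'C(#|T|, s)%:R; set m := (_ %/ 6).+1%:R; set N := #|regs T d|%:R.
pose rho : R := 101%:R / 100%:R; have rho1 : 1 <= rho by rewrite /rho; lra.
have s1_le : s.+1%:R <= 100%:R * rho ^+ s.
  have : 1 + 100%:R^-1 *+ s <= rho ^+ s.
    have -> : rho = 1 + 100%:R^-1 by rewrite /rho; field.
    by apply: Bernoulli_ineq; rewrite invr_ge0 ler0n.
  rewrite -(mulr_natr _ s) -[s.+1%:R]natr1; lra.
have pow_le : (4%:R / 5%:R)^-1 ^+ s <= 25%:R / 16%:R * 2%:R ^+ (s %/ 3) :> R.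
  have v0 : 0 <= (4%:R / 5%:R)^-1 :> R by rewrite invr_ge0; lra.
  rewrite {1}(divn_eq s 3) exprD mulrC mulnC exprM ler_pM ?exprn_ge0 ?v0 //.
    by have := ltn_pmod s (isT : (0 < 3)%N); case: (s %% 3)%N => [|[|[|]]] // _;
      rewrite ?expr0 ?expr1 ?expr2; lra.
  rewrite lerXn2r ?nnegrE ?ler0n ?exprn_ge0 ?v0 //.
  by rewrite !exprS expr0; lra.
have P0 : 0 < 2%:R ^+ (s %/ 3) :> R by rewrite exprn_gt0.
have rho_le : rho ^+ (6 * s) <= (9%:R / 10%:R) ^+ s * (25%:R / 16%:R * 2%:R ^+ (s %/ 3)).
  apply: le_trans (_ : (9%:R / 10%:R) ^+ s * (4%:R / 5%:R)^-1 ^+ s <= _); last first.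
    by rewrite ler_wpM2l // exprn_ge0 //; lra.
  rewrite exprM -exprMn lerXn2r ?nnegrE ?exprn_ge0 //; try lra.
  by rewrite /rho !exprS expr0; lra.
move=> h; rewrite -(ler_pM2r P0); set X := (9%:R / 10%:R) ^+ s.
have s1 : 0 <= s.+1%:R :> R := ler0n _ _.
have Nd : 0 <= N * d%:R by rewrite mulr_ge0.
apply: (@le_trans _ _ (2%:R * (N * d%:R) * (s.+1%:R ^+ 2 * c ^+ 2))).
  by have := ler_wpM2l s1 h; lra.
apply: (@le_trans _ _ (2%:R * (N * d%:R) * (10000%:R * rho ^+ (6 * s)))).
  rewrite ler_wpM2l ?mulr_ge0 //.
  have -> : 10000%:R * rho ^+ (6 * s) = (100%:R * rho ^+ s) ^+ 2 * (rho ^+ (2 * s)) ^+ 2.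
    by rewrite ![(_ * s)%N]mulnC !exprM; ring.
  have r0 n : 0 <= rho ^+ n by rewrite exprn_ge0 //; lra.
  by rewrite ler_pM ?exprn_ge0 ?ler0n // lerXn2r ?nnegrE ?mulr_ge0 ?ler0n.
have := ler_wpM2l Nd rho_le; rewrite /union_const -/X; lra.
Qed.

End Estimates.

(** The factor s + 1 of the previous lemma absorbs the number of values of k.
    Sets with one or two vertices are not covered by it, but A k <= s < A forces
    k = 0 for them, which is impossible in a d-regular graph. *)
Lemma card_few_crossings (R : realFieldType) (T : finType) d (S : {set T}) :
  (2 < d)%N -> (24 * d ^ 2 <= #|T|)%N -> (#|S|.*2 <= #|T|)%N -> (0 < #|S|)%N ->
  #|few_crossings d (expansion_inv d) S|%:R * ('C(#|T|, #|S|)%:R * (#|T| %/ 6).+1%:R) <=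
    #|regs T d|%:R * union_const R d * (9%:R / 10%:R) ^+ #|S| :> R.
Proof.
move=> d3 n24 S2 S0; set A := expansion_inv d.
have A3 : (2 < A)%N by rewrite /A /expansion_inv /expansion_scale expnS; have := expn_gt0 2 d; lia.
have rhs0 : 0 <= #|regs T d|%:R * union_const R d * (9%:R / 10%:R) ^+ #|S| :> R.
  by rewrite !mulr_ge0 ?exprn_ge0 ?ler0n //; lra.
have [S3|S3] := ltnP 2 #|S|; last first.
  suff -> : few_crossings d A S = set0 by rewrite cards0 mul0r.
  apply/setP => G; rewrite !inE; apply/negbTE/negP => /andP[regG few].
  have cut0 : edge_cut G S = 0%N by nia.
  by have := isolated_card regG S0 cut0; lia.
set b := _ * (_ %/ 6).+1%:R.
have sum_le : #|few_crossings d A S|%:R <=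
    \sum_(k < #|S|.+1 | (A * k <= #|S|)%N) #|reg_cut d S k|%:R :> R.
  rewrite -natr_sum ler_nat.
  rewrite -sum1_card (partition_big (fun G => inord (edge_cut G S) : 'I_#|S|.+1)
    (fun k : 'I_#|S|.+1 => (A * k <= #|S|)%N)) /=; last first.
    by move=> G; rewrite inE => /andP[_ few]; rewrite inordK //; nia.
  apply: leq_sum => k _; rewrite sum1_card; apply/subset_leq_card/subsetP => G.
  rewrite !inE -topredE /= inE => /andP[/andP[-> few] /eqP <-].
  by rewrite inordK //=; nia.
have s0 : 0 < #|S|.+1%:R :> R by rewrite ltr0n.
rewrite -(ler_pM2r s0); apply: le_trans (_ : (\sum_(k < #|S|.+1 | (A * k <= #|S|)%N)
   #|reg_cut d S k|%:R) * b * #|S|.+1%:R <= _).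
  by rewrite !ler_wpM2r // mulr_ge0.
rewrite -mulrA mulr_suml; set rhs := _ * _ ^+ _ in rhs0 *.
apply: le_trans (_ : \sum_(k < #|S|.+1) rhs <= _).
  rewrite big_mkcond ler_sum //= => k _; case: ifP => // Ak.
  by rewrite (mulrC b); apply: card_reg_cut_le.
by rewrite sumr_const card_ord mulr_natr.
Qed.

Definition nonexpanders (T : finType) d A : {set sgraph T} :=
  [set G | regular d G &&
    [exists S : {set T}, [&& 0 < #|S|, #|S|.*2 <= #|T| & A * edge_cut G S <= #|S|]%N]].

(** The union bound. Dividing by C(n, s) averages over the sets of size s, so
    that the total is a geometric series of ratio 9/10. *)
Lemma card_nonexpanders (R : realFieldType) (T : finType) d :
  (2 < d)%N -> (24 * d ^ 2 <= #|T|)%N ->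
  #|nonexpanders T d (expansion_inv d)|%:R * (#|T| %/ 6).+1%:R <=
    #|regs T d|%:R * (10%:R * union_const R d) :> R.
Proof.
move=> d3 n24; set A := expansion_inv d; set m := (_ %/ 6).+1%:R.
pose P (S : {set T}) := [&& 0 < #|S| & #|S|.*2 <= #|T|]%N.
have U0 : 0 <= #|regs T d|%:R * union_const R d by rewrite !mulr_ge0.
have union : #|nonexpanders T d A|%:R <= \sum_(S | P S) #|few_crossings d A S|%:R :> R.
  have sub : nonexpanders T d A \subset \bigcup_(S | P S) few_crossings d A S.
    apply/subsetP => G; rewrite inE => /andP[regG /existsP[S /and3P[S0 S2 few]]].
    by apply/bigcupP; exists S; rewrite /P ?S0 // inE regG.
  rewrite -natr_sum ler_nat; apply: leq_trans (subset_leq_card sub) _.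
  elim/big_ind2: _ => [|X x Y y leX leY|//]; first by rewrite cards0.
  by apply: leq_trans (leq_card_setU _ _) _; rewrite leq_add.
have m0 : 0 <= m by rewrite ler0n.
apply: le_trans (ler_wpM2r m0 union) _; rewrite mulr_suml.
pose x : R := 9%:R / 10%:R.
apply: (@le_trans _ _ (\sum_(S : {set T}) #|regs T d|%:R * union_const R d *
    (x ^+ #|S| / 'C(#|T|, #|S|)%:R))).
  rewrite [leRHS](bigID P) /= -[leLHS]addr0 lerD //; last first.
    apply: sumr_ge0 => S _; rewrite !mulr_ge0 ?invr_ge0 ?exprn_ge0 ?ler0n //.
    by rewrite /x; lra.
  apply: ler_sum => S /andP[S0 S2]; rewrite mulrA ler_pdivlMr.
    by rewrite -[leLHS]mulrA (mulrC m) card_few_crossings.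
  by rewrite ltr0n bin_gt0 max_card.
rewrite -mulr_sumr (mulrC 10%:R) [leRHS]mulrA ler_wpM2l //.
have -> : \sum_(S : {set T}) x ^+ #|S| / 'C(#|T|, #|S|)%:R = \sum_(s < #|T|.+1) x ^+ s.
  rewrite (partition_big (fun S : {set T} => inord #|S| : 'I_#|T|.+1) predT) //=.
  apply: eq_bigr => s _; have lesT : (s <= #|T|)%N by rewrite -ltnS.
  have cardE (S : {set T}) : (inord #|S| == s) = (#|S| == s).
    by rewrite -val_eqE /= inordK // ltnS max_card.
  rewrite (eq_bigl (fun S : {set T} => S \in [set S : {set T} | #|S| == s])); last first.
    by move=> S; rewrite inE cardE.
  rewrite (eq_bigr (fun=> x ^+ s / 'C(#|T|, s)%:R)) => [|S]; last by rewrite inE => /eqP ->.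
  by rewrite sumr_const card_draws -[LHS]mulr_natr divfK // pnatr_eq0 -lt0n bin_gt0.
have := subrX1 x #|T|.+1; have : 0 <= x ^+ #|T|.+1 by rewrite exprn_ge0 // /x; lra.
by rewrite /x; lra.
Qed.

(** * Existence of regular graphs *)

Local Open Scope nat_scope.

Lemma sum_interval N a b : \sum_(j < N) (a <= j < b)%N = minn b N - minn a N.
Proof. by elim: N => [|N IH]; rewrite ?big_ord0 ?big_ord_recr /= ?IH; lia. Qed.

Definition circulant_steps N d (j : nat) : bool :=
  [|| 1 <= j < d./2.+1, N - d./2 <= j < N | odd d && (N./2 <= j < N./2.+1)].

(** The circulant graph whose steps are the nonzero residues at distance at most d/2
    from 0, together with n/2 when d is odd; n is then even, so this step is its own
    opposite. *)
Lemma regs_neq0 n d : d < n -> ~~ odd (n * d) -> 0 < #|regs 'I_n d|.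
Proof.
case: n => // N dN even; set n := N.+1 in dN even *.
pose S := [set j : 'I_n | circulant_steps n d j].
have oddn : odd d -> (n./2).*2 = n.
  by move: even; rewrite oddM => + od; rewrite od andbT => en; rewrite even_halfK.
have cardS : #|S| = d.
  rewrite -sum1_card big_mkcond /=.
  transitivity (\sum_(j < n) ((1 <= j < d./2.+1) + (n - d./2 <= j < n) +
     odd d * (n./2 <= j < n./2.+1))).
    apply: eq_bigr => j _; rewrite inE /circulant_steps; move: oddn.
    by case: (odd d) => /= [/(_ isT)|_]; case: ifP; lia.
  rewrite !big_split /= -big_distrr /= !sum_interval.
  by move: oddn; rewrite -{5}(odd_double_half d); case: (odd d) => /= [/(_ isT)|_]; lia.
have S0 : 0%R \notin S.
  rewrite inE -[X in ~~ X]/(circulant_steps n d 0) /circulant_steps.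
  by move: (@odd_gt0 d); case: (odd d) => [/(_ isT)|_]; rewrite /n; lia.
have SN (j : 'I_n) : (- j)%R \in S = (j \in S).
  rewrite !inE /=; have [->|j0] := posnP j; first by rewrite subn0 modnn.
  rewrite modn_small; last by rewrite ltn_subrL j0.
  rewrite /circulant_steps; move: oddn (ltn_ord j) j0 dN; rewrite -/n.
  move: (nat_of_ord j) => i; clear; case: (odd d) => /= [/(_ isT)|_]; lia.
have ax : simple_graph_axiom [set a : 'I_n * 'I_n | (a.2 - a.1)%R \in S].
  apply/andP; split; apply/forallP => u; first by rewrite inE /= subrr.
  by apply/forallP => v; rewrite [X in X == _]finset.in_set [X in _ == X]finset.in_set /= -SN opprB.
apply/card_gt0P; exists (SGraph ax); rewrite inE; apply/regularP => u.
rewrite -[RHS]cardS -[RHS](card_imset _ (@addIr _ u)); apply: eq_card => v.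
rewrite [LHS]inE /adj [LHS]finset.in_set /=; apply/idP/imsetP.
  2: by move=> [j jS ->]; rewrite addrK.
move=> vu.
by exists (v - u)%R; rewrite ?subrK.
Qed.

(** * From edge expansion to the Poincare inequality *)

Definition level_set (T V : finType) (f : T -> V) (x : V) : {set T} :=
  [set u | f u == x].

(** Expansion is applied to the smaller of S and its complement, which have the
    same crossing edges. *)
Lemma expander_cut (T : finType) d A (G : sgraph T) (S : {set T}) :
  regular d G -> G \notin nonexpanders T d A ->
  #|S| * #|~: S| <= #|T| * (A * edge_cut G S).
Proof.
move=> regG; rewrite inE regG /= negb_exists => /forallP exp.
have small (S' : {set T}) : #|S'|.*2 <= #|T| -> #|S'| <= A * edge_cut G S'.
  move=> S2; have [-> //|S0] := posnP #|S'|.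
  by have := exp S'; rewrite S0 S2 /= -ltnNge => /ltnW.
have := cardsC S; have := small S; have := small (~: S); rewrite edge_cutC.
have [S2 _ /(_ isT) h e|S2 h _ e] := leqP #|S|.*2 #|T|.
  by rewrite mulnC leq_mul // -e leq_addl.
by rewrite leq_mul //; [rewrite -e leq_addr|apply: h; lia].
Qed.

(** The Poincare inequality for the discrete metric: the left side counts the
    pairs of vertices with different values of f, the sum on the right the pairs
    that are moreover adjacent. Both split over the values of f. *)
Lemma expander_levels (T V : finType) d A (G : sgraph T) (f : T -> V) :
  regular d G -> G \notin nonexpanders T d A ->
  \sum_u #|~: level_set f (f u)| <=
    #|T| * A * \sum_u #|nbrs G u :&: ~: level_set f (f u)|.
Proof.
move=> regG exp; rewrite (partition_big f predT) //= [X in _ <= _ * X](partition_big f predT) //=.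
rewrite big_distrr /= leq_sum // => x _.
rewrite (eq_bigr (fun=> #|~: level_set f x|)) => [|u /eqP -> //].
rewrite [X in _ <= _ * X](eq_bigr (fun u => #|nbrs G u :&: ~: level_set f x|)) => [|u /eqP -> //].
rewrite sum_nat_const -mulnA; have := expander_cut (level_set f x) regG exp.
rewrite /edge_cut card_arcs_between; congr (_ * _ <= _ * (_ * _)).
  by apply: eq_card => u; rewrite inE.
by apply: eq_bigl => u; rewrite inE.
Qed.

Local Open Scope ring_scope.

(** Passing from the discrete metric to dX costs the lower bound 1 for dX^2,
    used on the adjacent pairs, and its upper bound D, used on all pairs. *)
Lemma expander_poincare (R : realType) (n d A : nat) (G : sgraph 'I_n) (V : finType)
    (dX : V -> V -> R) (D : R) : (0 < n)%N -> (0 < d)%N ->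
  (forall x, dX x x = 0) -> (forall x y, x != y -> 1 <= dX x y ^+ 2) ->
  (forall x y, dX x y ^+ 2 <= D) ->
  regular d G -> G \notin nonexpanders 'I_n d A ->
  poincare d G dX (D * A%:R * d%:R).
Proof.
move=> n0 d0 dXx dX1 dXD regG exp f.
have n0R : 0 < n%:R :> R by rewrite ltr0n.
have D0 : 0 <= D by case: n n0 G regG exp f {n0R} => // n _ G _ _ f;
  rewrite (le_trans _ (dXD (f ord0) (f ord0))) // sqr_ge0.
set E := \sum_(u : 'I_n) \sum_(v | adj G u v) _; set F := \sum_u _.
suff le : F <= D * (n%:R * A%:R * E).
  rewrite [leRHS](_ : _ = 1 / n%:R ^+ 2 * (D * (n%:R * A%:R * E))).
    by rewrite ler_wpM2l // mul1r invr_ge0 exprn_ge0 // ltW.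
  by field; rewrite !pnatr_eq0 -!lt0n n0 d0.
pose L u := level_set f (f u).
apply: (@le_trans _ _ (D * (\sum_u #|~: L u|)%:R)).
  rewrite natr_sum mulr_sumr; apply: ler_sum => u _.
  rewrite (bigID (mem (L u))) /= big1 ?add0r => [|v]; last first.
    by rewrite inE => /eqP ->; rewrite dXx expr0n.
  rewrite mulr_natr -sumr_const; apply: (@le_trans _ _ (\sum_(v in ~: L u) D)) => //.
  by rewrite [leRHS](eq_bigl (fun v => v \notin L u)) ?ler_sum // => v; rewrite inE.
rewrite ler_wpM2l //.
have := expander_levels f regG exp; rewrite card_ord -(ler_nat R) => /le_trans; apply.
rewrite !natrM ler_wpM2l ?mulr_ge0 ?ler0n // natr_sum ler_sum // => u _.
rewrite -sum1_card natr_sum (bigID (mem (L u))) /= big1 ?add0r => [|v]; last first.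
  by rewrite !inE => /andP[/andP[_ /negP]].
apply: le_trans (_ : \sum_(v | adj G u v && (v \notin L u)) dX (f u) (f v) ^+ 2 <= _).
  rewrite (eq_bigl (fun v => adj G u v && (v \notin L u))) => [|v]; last first.
    by rewrite !inE -andbA andbb.
  apply: ler_sum => v /andP[_ vL]; rewrite mulr1n dX1 // eq_sym.
  by move: vL; rewrite inE.
rewrite [leRHS](bigID (mem (L u))) /= lerDr sumr_ge0 // => v _; exact: sqr_ge0.
Qed.

(** * The metric of a finite connected graph *)

Local Open Scope classical_set_scope.

(** Connectedness matters: without a walk from x to y the distance is the infimum
    of the empty set, hence 0. *)
Lemma graph_dist_ge (R : realType) (V : finType) (H : sgraph V) (x y : V) (k : nat) :
  connected_graph H ->
  (forall p, path (adj H) x p -> last x p = y -> (k <= size p)%N) ->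
  k%:R <= graph_dist R H x y.
Proof.
move=> /forallP/(_ x)/forallP/(_ y)/connectP[p px py] h.
apply: lb_le_inf; first by exists (size p)%:R; exists p.
by move=> _ [q [qx qy] <-]; rewrite ler_nat h.
Qed.

Lemma graph_dist_refl (R : realType) (V : finType) (H : sgraph V) (x : V) :
  graph_dist R H x x = 0.
Proof.
apply/eqP; rewrite eq_le; apply/andP; split.
  apply: ge_inf; last by exists [::].
  by exists 0 => _ [p _ <-].
by apply: lb_le_inf; [exists 0; exists [::]|move=> _ [p _ <-]].
Qed.

(** * The limit *)

Lemma prob_Gnd_close (R : realType) n d (E : sgraph 'I_n -> Prop) :
  (2 < d)%N -> (24 * d ^ 2 <= n)%N -> ~~ odd (n * d) ->
  (forall G, regular d G -> G \notin nonexpanders 'I_n d (expansion_inv d) -> E G) ->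
  `|1 - prob_Gnd R n d E| <= 10%:R * union_const R d / (n %/ 6).+1%:R.
Proof.
move=> d3 n24 even expE; set B := nonexpanders 'I_n d _ in expE.
pose good := [set G : sgraph 'I_n | regular d G && `[< E G >]]%SET.
have -> : prob_Gnd R n d E = #|good|%:R / #|regs 'I_n d|%:R.
  by rewrite /prob_Gnd /regs !cardsE.
have N0 : 0 < #|regs 'I_n d|%:R :> R.
  by rewrite ltr0n regs_neq0 //; apply: leq_trans n24; nia.
have good_le : (#|good| <= #|regs 'I_n d|)%N.
  by apply/subset_leq_card/fintype.subsetP => G; rewrite !inE => /andP[].
have le_good : (#|regs 'I_n d| <= #|good| + #|B|)%N.
  apply: leq_trans (leq_card_setU good B); apply/subset_leq_card/fintype.subsetP => G.
  rewrite finset.in_setU inE [G \in good]finset.in_set => regG; rewrite regG /=.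
  by have [GB|GB] := boolP (G \in B); rewrite ?orbT // orbF; apply/asboolP/expE.
rewrite ger0_norm; last by rewrite subr_ge0 ler_pdivrMr // mul1r ler_nat.
apply: (@le_trans _ _ (#|B|%:R / #|regs 'I_n d|%:R)).
  rewrite lerBlDr -mulrDl ler_pdivlMr // mul1r -natrD ler_nat addnC //.
rewrite ler_pdivrMr // mulrAC ler_pdivlMr ?ltr0n // mulrC.
by have := @card_nonexpanders R 'I_n d d3; rewrite card_ord mulrC [leRHS]mulrC; apply.
Qed.

Theorem theorem1 (R : realType) (m d : nat) (hm : (0 < m)%N) (hd : (2 < d)%N)
    (V : finType) (hV : #|V| = m) (H : sgraph V)
    (Hconn : connected_graph H) (Hreg : regular d H) :
  exists C : R,
    prob_Gnd R n d (fun G => (gamma d G (graph_dist R H) <= C%:E)%E)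
      @[n --> within [set n : nat | ~~ odd (n * d)] \oo] --> (1 : R).
Proof.
(* Any bound for the squared distances in H would do. *)
pose D : R := \sum_x \sum_y graph_dist R H x y ^+ 2.
have dist_le x y : graph_dist R H x y ^+ 2 <= D.
  rewrite /D (bigD1 x) //= (bigD1 y) //= -addrA lerDl addr_ge0 ?sumr_ge0 // => i _.
    exact: sqr_ge0.
  by rewrite sumr_ge0 // => j _; exact: sqr_ge0.
have dist_ge1 x y : x != y -> 1 <= graph_dist R H x y ^+ 2.
  move=> xy; rewrite exprn_ege1 //; apply: (@graph_dist_ge R V H x y 1 Hconn).
  by case=> //= _ /eqP; rewrite (negbTE xy).
exists (D * (expansion_inv d)%:R * d%:R).
apply/cvgrPdist_lt => e e0; rewrite near_withinE.
pose K := 10%:R * union_const R d.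
have K0 : 0 <= K by rewrite !mulr_ge0.
(* The first summand makes n/6 + 1 larger than K/e. *)
exists (6 * Num.bound (K / e) + 24 * d ^ 2)%N => // n /= n_ge even.
have n24 : (24 * d ^ 2 <= n)%N by apply: leq_trans n_ge; rewrite leq_addl.
apply: le_lt_trans (prob_Gnd_close R hd n24 even _) _ => [G regG exp|].
  apply: ereal_inf_lbound; exists (D * (expansion_inv d)%:R * d%:R) => //.
  have d0 : (0 < d)%N by apply: leq_trans hd.
  have n0 : (0 < n)%N by apply: leq_trans n24; rewrite muln_gt0 expn_gt0 d0.
  by apply: expander_poincare => // x; exact: graph_dist_refl.
rewrite ltr_pdivrMr ?ltr0n // (mulrC e) -ltr_pdivrMr //.
have Ke0 : 0 <= K / e by apply: divr_ge0 => //; apply: ltW.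
apply: lt_le_trans (archi_boundP Ke0) _.
by rewrite ler_nat; move: n_ge; move: (Num.bound _) (d ^ 2)%N => a b; lia.
Qed.
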